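(* Let $K$ be a field of prime characteristic $p>0$, let $L=K(\theta)\simeq K[x]/(f(x))$ be a simple finite field extension of $K$, where $f(x)=f^{sep}(x^{p^n})=\sum_{i=0}^s\lambda_i x^{ip^n}\in K[x]$ (with $\lambda_i\in K$, $\lambda_s=1$) is the monic irreducible minimal polynomial of $\theta$ over $K$, written in its separable presentation, and let $N/K$ be a purely inseparable field extension. Write $(NL)^{sep}:=(NL/N)^{sep}$ and $(NL)^{pi}:=(NL/N)^{pi}$. Then the following statements are equivalent: 1. $NL=(NL)^{pi}(NL)^{sep}$ $\big(=(NL)^{pi}\otimes_N(NL)^{sep}\big)$. 2. $\lambda_i^{1/p^n}\in NL$ for all $i=1,\ldots,s-1$; equivalently, $n=m_{f,N}+m_{f,N(\theta)}$. 3. $(NL)^{pi}=N\big(\lambda_0^{1/p^n},\ldots,\lambda_{s-1}^{1/p^n}\big)$.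
   Context: Fix an algebraic closure $\overline{K}$ of $K$ containing all fields considered (in particular $L$ and $N$); $AB$ denotes the compositum in $\overline{K}$, and $NL=N(\theta)$. The extension $N/K$ is not assumed finite. For $\lambda\in\overline{K}$ and $k\ge 0$, $\lambda^{1/p^k}$ denotes the unique $p^k$-th root of $\lambda$ in $\overline{K}$. $(NL/N)^{sep}$ and $(NL/N)^{pi}$ are the maximal separable and maximal purely inseparable subextensions of $NL/N$; the identification $(NL)^{pi}(NL)^{sep}=(NL)^{pi}\otimes_N(NL)^{sep}$ is via the natural map $a\otimes b\mapsto ab$. Separable presentation: every non-scalar $f\in K[x]$ considered is written uniquely as $f(x)=f^{sep}(x^{p^n})$ with $f^{sep}\in K[x]$ a separable polynomial and $n\ge 0$; $n$ is the inseparability degree of $f$. Here $f^{sep}(x)=\sum_{i=0}^s\lambda_i x^i$. Definitions: - $m_{f,N}:=\max\{m'\in\{0,\ldots,n\}\mid \lambda_i^{1/p^{m'}}\in N\text{ for all }i=0,\ldots,s-1\}$; - $m_{f,N(\theta)}:=\max\{m'\in\{0,\ldots,n-m_{f,N}\}\mid \lambda_i^{1/p^{m_{f,N}+m'}}\in NL\text{ for all }i=0,\ldots,s-1\}$. *)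

(* Defs.v *)
From HB Require Import structures.
From mathcomp Require Export all_boot all_order all_algebra all_field.
From mathcomp Require Export boolp classical_sets.

Set Implicit Arguments.
Unset Strict Implicit.
Unset Printing Implicit Defensive.

Import GRing.Theory.

Local Open Scope classical_set_scope.
Local Open Scope ring_scope.

(* Field extensions need not be finite. An extension E/F is an embedding
   iota : {rmorphism F -> E}; its intermediate fields are subsets of E. *)

Definition is_subfield (E : fieldType) (M : set E) : Prop :=
  GRing.divring_closed [in M].

Definition gen_field (E : fieldType) (S : set E) : set E :=
  smallest (@is_subfield E) S.

Definition adjoin (E : fieldType) (A S : set E) : set E :=
  gen_field (A `|` S).

Definition compositum (E : fieldType) (A B : set E) : set E :=
  gen_field (A `|` B).

Section Extensions.

Variables (F E : fieldType) (iota : {rmorphism F -> E}).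

(* The polynomial q below is the minimal polynomial of x over F. *)
Definition separable_elt (x : E) : Prop :=
  exists q : {poly F},
    [/\ q \is monic, irreducible_poly q, root (map_poly iota q) x
      & separable_poly q].

Definition separable_ext (M : set E) : Prop :=
  forall x, M x -> separable_elt x.

Definition purely_inseparable_ext (p : nat) (M : set E) : Prop :=
  forall x, M x -> exists k : nat, range iota (x ^+ (p ^ k)).

Definition subextension (M A : set E) : Prop :=
  [/\ is_subfield A, range iota `<=` A & A `<=` M].

(* The maximal (that is, largest) separable, resp. purely inseparable,
   subextension is the union of all of them. *)
Definition max_sep (M : set E) : set E :=
  \bigcup_(A in [set A | subextension M A /\ separable_ext A]) A.

Definition max_pi (p : nat) (M : set E) : set E :=
  \bigcup_(A in [set A | subextension M A /\ purely_inseparable_ext p A]) A.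

(* Maps out of subsets of E are represented by total functions on E whose
   values outside these subsets are irrelevant. *)
Definition linear_on (V : lmodType F) (C : set E) (phi : E -> V) : Prop :=
  forall (c : F) (x y : E), C x -> C y ->
    phi (iota c * x + y) = c *: phi x + phi y.

Definition bilinear_on (V : lmodType F) (A B : set E) (beta : E -> E -> V) :
    Prop :=
  (forall b, B b -> linear_on A (beta^~ b)) /\
  (forall a, A a -> linear_on B (beta a)).

(* C together with the multiplication map A x B -> C, (a, b) |-> a * b, has the
   universal property of the tensor product of A and B over F; equivalently,
   a (x) b |-> a * b is an isomorphism from the tensor product onto C. *)
Definition is_tensor_product (A B C : set E) : Prop :=
  (forall a b, A a -> B b -> C (a * b)) /\
  (forall (V : lmodType F) (beta : E -> E -> V), bilinear_on A B beta ->
     exists phi : E -> V,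
       [/\ linear_on C phi,
           forall a b, A a -> B b -> phi (a * b) = beta a b
         & forall psi : E -> V, linear_on C psi ->
             (forall a b, A a -> B b -> psi (a * b) = beta a b) ->
             forall x, C x -> psi x = phi x]).

End Extensions.

(* See proot_spec and proot_uniq; the default value 0 is never used in an
   algebraically closed field. *)
Definition proot (E : fieldType) (p k : nat) (x : E) : E :=
  xget 0 [set y | y ^+ (p ^ k) = x].

Lemma proot_spec (E : closedFieldType) (p k : nat) (x : E) :
  p \in [pchar E] -> proot p k x ^+ (p ^ k) = x.
Proof.
move=> hp; rewrite /proot; case: xgetP => [y _ //|noroot].
have p_gt0 : (0 < p ^ k)%N by rewrite expn_gt0 prime_gt0 // (pcharf_prime hp).
have : size ('X^(p ^ k) - x%:P) != 1%N.
  by rewrite size_XnsubC // eqSS -lt0n.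
case/closed_rootP => y; rewrite rootE !hornerE subr_eq0 => /eqP hy.
by case: (noroot y).
Qed.

Lemma proot_uniq (E : closedFieldType) (p k : nat) (x y : E) :
  p \in [pchar E] -> y ^+ (p ^ k) = x -> y = proot p k x.
Proof.
move=> hp hy; have := proot_spec k x hp; rewrite -{2}hy => {hy}.
elim: k (proot p k x) => [|k IHk] z; first by rewrite !expr1.
rewrite expnSr !exprM => h; apply: IHk.
by apply: (fmorph_inj (pFrobenius_aut hp)); rewrite /= !pFrobenius_autE.
Qed.

(* In the next two definitions the polynomial is fsep(x^(p^n)), with
   fsep = \sum_(i <= s) lambda_i x^i over K embedded in E by iota,
   and s = (size fsep).-1. *)

Definition m_base (K E : fieldType) (iota : {rmorphism K -> E}) (p n : nat)
    (fsep : {poly K}) (N : set E) : nat :=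
  \max_(m < n.+1 | `[< forall i : nat, (i < (size fsep).-1)%N ->
                         N (proot p m (iota fsep`_i)) >]) m.

Definition m_adjoin (K E : fieldType) (iota : {rmorphism K -> E}) (p n : nat)
    (fsep : {poly K}) (N NL : set E) : nat :=
  let mN := m_base iota p n fsep N in
  \max_(m < (n - mN).+1 | `[< forall i : nat, (i < (size fsep).-1)%N ->
                         NL (proot p (mN + m) (iota fsep`_i)) >]) m.

(* Main.v *)
(* Put q = p^n and alpha = theta^q, a root of fsep. A polynomial w whose
   coefficients are purely inseparable over K and which vanishes at alpha
   vanishes at all conjugates of alpha: a Frobenius twist of w, evaluated at a
   power of 'X, is a multiple of f. Since fsep is separable it divides w, hence
   1, alpha, .., alpha^(s-1) are linearly independent over every purely
   inseparable extension of K. This gives the tensor product decomposition, as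
   (NL)^sep = N(alpha), and the rest follows from it and from the polynomial
   g = sum_i lambda_i^(1/q) X^i, which satisfies g^q = f.
   If theta is in (NL)^pi(alpha) then theta has degree s over (NL)^pi, and the
   Frobenius twist of its relation of degree s is proportional to fsep, so that
   g has its coefficients in (NL)^pi. If g has its coefficients in NL, let M be
   the field that they generate over N; an element x = sum_(i < s) c_i theta^i
   of (NL)^pi with c_i in M satisfies x^q = sum_i c_i^q alpha^i, so x = c_0.
   Finally, if g has its coefficients in (NL)^pi then theta is both separable
   and purely inseparable over (NL)^pi(alpha). *)

Require Import Defs.
From HB Require Import structures.

Set Implicit Arguments.
Unset Strict Implicit.
Unset Printing Implicit Defensive.

Import GRing.Theory.

Local Open Scope classical_set_scope.
Local Open Scope ring_scope.

(** * Subfields as sets and as images of embeddings *)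

(** The subtype of [E] cut out by [M] inherits a field structure. Results stated for an embedding,
    such as those on gcds and irreducibility, thereby apply to a subfield given as a set. *)
Lemma subfield_range (E : fieldType) (M : set E) : is_subfield M ->
  exists (F : fieldType) (iota : {rmorphism F -> E}), range iota = M.
Proof.
move=> hM; pose P : pred E := [in M].
pose T := {x : E | P x}.
pose c1 := GRing.SubChoice_isSubIntegralDomain.Build E P T hM.
pose T1 : subIdomainType P := HB.pack T c1.
pose c2 := GRing.SubIntegralDomain_isSubField.Build E P T1 (frefl _).
pose T2 : subFieldType P := HB.pack (GRing.SubIntegralDomain.sort T1) c2.
exists T2, (val : {rmorphism T2 -> E}).
apply/seteqP; split=> [_ [x _ <-]|x Mx].
  by apply/set_mem; exact: (valP x).
have Px : P x by exact/mem_set.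
by exists (Sub x Px : T2) => //; exact: SubK.
Qed.

Lemma range_is_subfield (F E : fieldType) (iota : {rmorphism F -> E}) :
  is_subfield (range iota).
Proof.
split; first by rewrite inE; exists 1; rewrite // rmorph1.
  move=> x y; rewrite !inE => -[a _ <-] [b _ <-].
  by exists (a - b); rewrite // rmorphB.
move=> x y; rewrite !inE => -[a _ <-] [b _ <-].
by exists (a / b); rewrite // fmorph_div.
Qed.

Section Subfield.

Variables (E : fieldType) (M : set E).
Hypothesis hM : is_subfield M.

Lemma subfield1 : M 1.
Proof. by have [+ _ _] := hM; rewrite inE. Qed.

Lemma subfieldB x y : M x -> M y -> M (x - y).
Proof. by have [_ + _] := hM => /(_ x y); rewrite !inE. Qed.

Lemma subfieldV x : M x -> M x^-1.
Proof.
have [_ _ /(_ 1 x)] := hM; rewrite !inE div1r; apply; exact: subfield1.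
Qed.

Lemma subfield0 : M 0.
Proof. by rewrite -(subrr 1); apply: subfieldB; exact: subfield1. Qed.

Lemma subfieldD x y : M x -> M y -> M (x + y).
Proof.
move=> Mx My; rewrite -[y]opprK -[- y]sub0r.
by do 2?[apply: subfieldB => //]; exact: subfield0.
Qed.

Lemma subfieldM x y : M x -> M y -> M (x * y).
Proof.
move=> Mx My; rewrite -[y]invrK.
by have [_ _ /(_ x y^-1)] := hM; rewrite !inE; apply=> //; exact: subfieldV.
Qed.

Lemma subfield_sum (I : Type) (r : seq I) (P : pred I) (u : I -> E) :
  (forall i, P i -> M (u i)) -> M (\sum_(i <- r | P i) u i).
Proof.
by move=> h; elim/big_ind: _ => //; [exact: subfield0|exact: subfieldD].
Qed.

Lemma subfieldX x n : M x -> M (x ^+ n).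
Proof.
move=> Mx; elim: n => [|n IHn]; first exact: subfield1.
by rewrite exprS; exact: subfieldM.
Qed.

Lemma subfield_horner (w : {poly E}) x : (forall i, M w`_i) -> M x -> M w.[x].
Proof.
move=> hw Mx; rewrite horner_coef; apply: subfield_sum => i _.
by apply: subfieldM => //; exact: subfieldX.
Qed.

End Subfield.

Lemma subfieldI (E : fieldType) (A B : set E) :
  is_subfield A -> is_subfield B -> is_subfield (A `&` B).
Proof.
move=> hA hB; split=> [|x y|x y]; rewrite !inE.
- by split; [exact: (subfield1 hA)|exact: (subfield1 hB)].
- move=> [Ax Bx] [Ay By].
  by split; [exact: (subfieldB hA)|exact: (subfieldB hB)].
move=> [Ax Bx] [Ay By]; split.
  by apply: (subfieldM hA) => //; exact: (subfieldV hA).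
by apply: (subfieldM hB) => //; exact: (subfieldV hB).
Qed.

Section Generated.

Variable E : fieldType.
Implicit Types A B S : set E.

Lemma gen_field_subfield S : is_subfield (gen_field S).
Proof.
split.
- by rewrite inE => A [hA _]; exact: (subfield1 hA).
- move=> x y; rewrite !inE => hx hy A hA.
  by apply: (subfieldB hA.1); [exact: hx|exact: hy].
move=> x y; rewrite !inE => hx hy A hA.
apply: (subfieldM hA.1); first exact: hx.
by apply: (subfieldV hA.1); exact: hy.
Qed.

Lemma gen_field_sub S A : is_subfield A -> S `<=` A -> gen_field S `<=` A.
Proof. exact: smallest_sub. Qed.

Lemma compositum_l A B : A `<=` compositum A B.
Proof. by move=> x Ax; apply: sub_gen_smallest; left. Qed.

Lemma compositum_r A B : B `<=` compositum A B.
Proof. by move=> x Ax; apply: sub_gen_smallest; right. Qed.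

End Generated.

(** * Polynomials over the base of an extension *)

Section Poly.

Variables (F E : fieldType) (iota : {rmorphism F -> E}).

Lemma poly_range (w : {poly E}) : (forall i, range iota w`_i) ->
  exists v, w = map_poly iota v.
Proof.
move=> hw; pose c i := xget 0 [set a | iota a = w`_i].
have hc i : iota (c i) = w`_i.
  by rewrite /c; case: xgetP => [a _ //|]; have [a _ <-] := hw i => /(_ a) [].
exists (\poly_(i < size w) c i); apply/polyP => i.
rewrite coef_map coef_poly /= -hc; case: ltnP => // hi.
by rewrite hc nth_default // rmorph0.
Qed.

(** Otherwise [q] and [h] are coprime over [F], hence over [E], which excludes a common root. *)
Lemma irreducible_dvdp (q h : {poly F}) x : irreducible_poly q ->
  root (map_poly iota q) x -> root (map_poly iota h) x -> q %| h.
Proof.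
move=> irr rq rh; rewrite -[_ %| _]negbK -irreducible_poly_coprime //.
apply/negP; rewrite -(coprimep_map iota) => /coprimep_root/(_ rq).
by rewrite -[_ == 0]/(root _ _) rh.
Qed.

(** Take a nonzero polynomial of least size vanishing at [x] and make it monic: in a factorization
    one factor vanishes at [x], so by minimality it has full size. *)
Lemma algebraic_irreducible x : algebraicOver iota x ->
  exists q : {poly F},
    [/\ q \is monic, irreducible_poly q & root (map_poly iota q) x].
Proof.
move=> [h h0 rh].
pose P m := `[< exists g : {poly F},
  [/\ g != 0, root (map_poly iota g) x & size g = m] >].
have exP : exists m, P m by exists (size h); apply/asboolP; exists h.
case: (ex_minnP exP) => _ /asboolP[g [g0 rg <-]] ming.
have le_g d : d != 0 -> root (map_poly iota d) x -> (size g <= size d)%N.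
  by move=> d0 rd; apply: ming; apply/asboolP; exists d.
have lg0 : lead_coef g != 0 by rewrite lead_coef_eq0.
exists ((lead_coef g)^-1 *: g); rewrite monicE lead_coefZ mulVf //.
have rq : root (map_poly iota ((lead_coef g)^-1 *: g)) x.
  by rewrite map_polyZ rootZ // fmorph_eq0 invr_eq0.
split=> //; split=> [|d d1].
  rewrite size_scale ?invr_eq0 // -(size_map_poly iota).
  by apply: (root_size_gt1 (a := x)); rewrite ?map_poly_eq0.
rewrite dvdpZr ?invr_eq0 // => /dvdpP[e ge].
have [e0 d0] : e != 0 /\ d != 0 
    by apply/andP; rewrite -negb_or -mulf_eq0 -ge.
suff: d %= g by move/eqp_trans; apply; rewrite eqp_sym eqp_scale ?invr_eq0.
have dg : d %| g by rewrite ge dvdp_mulIr.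
have /orP[re|rd] : root (map_poly iota e) x || root (map_poly iota d) x.
    by rewrite -rootM -rmorphM -ge.
  move: (le_g e e0 re); rewrite ge size_mul //.
  case: (size d) (d1) (size_poly_gt0 d) => [|[|k]] //; rewrite ?d0 //.
  by rewrite addnS /= addnS => _ _; rewrite ltnNge leq_addr.
by rewrite -dvdp_size_eqp // eqn_leq dvdp_leq // le_g.
Qed.

End Poly.

(** * Descent of a polynomial relation from an extension to its base *)

(** This turns composition with [h] modulo [r] into linear algebra: once [n] is large enough to hold
    the remainders, the left kernel of the matrix consists of the [u] with [r] dividing
    [u \Po h]. *)
Lemma mul_comp_modp_mx (F : fieldType) (r h : {poly F}) m n (u : 'rV_m) :
  u *m \matrix_(i < m) poly_rV (h ^+ i %% r) =
    poly_rV ((rVpoly u \Po h) %% r) :> 'rV_n.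
Proof.
rewrite mulmx_sum_row {2}(row_sum_delta u) 2!linear_sum.
rewrite (big_morph _ (modpD r) (mod0p r)) linear_sum.
apply: eq_bigr => i _.
by rewrite rowK linearZ /= rVpoly_delta comp_polyZ comp_Xn_poly modpZl linearZ.
Qed.

(* The matrix of the powers of h modulo r has the same rank over E as over F. *)
Lemma descent_relation (F E : fieldType) (iota : {rmorphism F -> E})
    (r h : {poly F}) (t : {poly E}) : r != 0 -> t != 0 ->
    map_poly iota r %| t \Po map_poly iota h ->
  exists u : {poly F}, [/\ u != 0, (size u <= size t)%N & r %| u \Po h].
Proof.
move=> r0 t0 rt; pose m := size t.
pose T := \matrix_(i < m) poly_rV (h ^+ i %% r) : 'M_(m, size r).
pose v : 'rV_m := poly_rV t.
have v0 : v != 0.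
  by rewrite -(inj_eq (can_inj rVpolyK)) linear0 poly_rV_K.
have vT : v *m map_mx iota T = 0.
  have -> : map_mx iota T =
      \matrix_i poly_rV (map_poly iota h ^+ i %% map_poly iota r).
    apply/row_matrixP => i.
    by rewrite -map_row !rowK map_poly_rV map_modp rmorphXn.
  by rewrite mul_comp_modp_mx poly_rV_K // modp_eq0 // linear0.
have /rowV0Pn[u uT u0] : kermx T != 0.
  apply: contraNneq v0 => kT0; apply/eqP.
  apply: (row_free_inj (A := map_mx iota T)); last by rewrite vT mul0mx.
  by rewrite -kermx_eq0 -map_kermx kT0 map_mx0.
exists (rVpoly u); split.
- apply: contraNneq u0 => /(congr1 (@poly_rV F m)); rewrite rVpolyK => ->.
  by rewrite linear0.
- exact: size_poly.
have : rVpoly (u *m T) = 0 by rewrite (sub_kermxP uT) linear0.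
rewrite mul_comp_modp_mx poly_rV_K => [/modp_eq0P //|].
by rewrite ltnW ?ltn_modp.
Qed.

(** * Frobenius twists *)

(** The proof of [p \in [pchar E]] is an argument so that a ring morphism structure can be attached
    to the map. *)
Definition frobn (E : fieldType) (p : nat) of p \in [pchar E] :=
  fun (n : nat) (x : E) => x ^+ (p ^ n).

Section Frobenius.

Variables (E : fieldType) (p : nat) (hp : p \in [pchar E]) (n : nat).

Fact frobn_is_zmod_morphism : zmod_morphism (frobn hp n).
Proof.
have hq : [pchar E].-nat (p ^ n)%N.
  by rewrite pnatX pnatE ?hp // (pcharf_prime hp).
by move=> x y; rewrite /frobn exprDn_pchar // exprNn_pchar.
Qed.

Fact frobn_is_monoid_morphism : monoid_morphism (frobn hp n).
Proof. by split=> [|x y]; rewrite /frobn ?expr1n ?exprMn. Qed.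

HB.instance Definition _ :=
  GRing.isZmodMorphism.Build E E (frobn hp n) frobn_is_zmod_morphism.
HB.instance Definition _ :=
  GRing.isMonoidMorphism.Build E E (frobn hp n) frobn_is_monoid_morphism.

Lemma frobn_inj : injective (frobn hp n).
Proof. exact: fmorph_inj. Qed.

Lemma frobn_eq0 x : (frobn hp n x == 0) = (x == 0).
Proof. exact: fmorph_eq0. Qed.

Lemma frobn_horner (w : {poly E}) x :
  frobn hp n w.[x] = (map_poly (frobn hp n) w).[x ^+ (p ^ n)].
Proof. by rewrite -horner_map. Qed.

End Frobenius.

(** Up to a scalar, [g] is a product of distinct linear factors, each of which divides [w]. *)
Lemma separable_dvdp (E : closedFieldType) (g w : {poly E}) :
  separable_poly g -> (forall x, root g x -> root w x) -> g %| w.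
Proof.
move=> sep_g gw; have g0 := separable_poly_neq0 sep_g.
have [rs grs] := closed_field_poly_normal g.
have lg0 : lead_coef g != 0 by rewrite lead_coef_eq0.
rewrite grs dvdpZl //; apply: uniq_roots_dvdp.
  apply/allP => x x_rs; apply: gw.
  by rewrite grs rootZ // root_prod_XsubC.
rewrite uniq_rootsE -separable_prod_XsubC.
by apply: dvdp_separable sep_g; rewrite [X in _ %| X]grs dvdpZr.
Qed.

(** * Elements purely inseparable over the base *)

Section PurelyInseparable.

Variables (F E : fieldType) (iota : {rmorphism F -> E}) (p : nat).
Hypothesis hp : p \in [pchar E].

(** The relative perfect closure of [F] in [E]. *)
Definition pi_elts : set E := [set x | exists k, range iota (x ^+ (p ^ k))].

Lemma range_expX k j x :
  range iota (x ^+ (p ^ k)) -> range iota (x ^+ (p ^ (k + j))).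
Proof.
move=> hx; rewrite expnD exprM; apply: subfieldX hx.
exact: range_is_subfield.
Qed.

Lemma range_pi_elts : range iota `<=` pi_elts.
Proof. by move=> x hx; exists 0%N; rewrite expn0 expr1. Qed.

Lemma pi_elts_subfield : is_subfield pi_elts.
Proof.
have hR := range_is_subfield iota.
split=> [|x y|x y]; rewrite !inE.
- by apply: range_pi_elts; exact: subfield1.
- move=> [k hx] [j hy]; exists (k + j)%N.
  rewrite -[_ ^+ _]/(frobn hp (k + j) (x - y)) rmorphB; apply: subfieldB => //.
    exact: range_expX.
  by rewrite addnC; exact: range_expX.
move=> [k hx] [j hy]; exists (k + j)%N.
rewrite -[_ ^+ _]/(frobn hp (k + j) (x / y)) rmorphM fmorphV.
apply: subfieldM => //; first exact: range_expX.
by apply: subfieldV => //; rewrite addnC; exact: range_expX.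
Qed.

(** There are finitely many coefficients and exponents may be enlarged, so one exponent serves for
    all. *)
Lemma pi_elts_poly (w : {poly E}) : (forall i, pi_elts w`_i) ->
  exists k v, map_poly (frobn hp k) w = map_poly iota v.
Proof.
move=> hw.
have [k hk] : exists k, forall i, (i < size w)%N ->
    range iota (w`_i ^+ (p ^ k)).
  elim: (size w) => [|m [k hk]]; first by exists 0%N.
  have [j hj] := hw m; exists (k + j)%N => i.
  rewrite ltnS leq_eqVlt => /orP[/eqP ->|/hk]; last exact: range_expX.
  by rewrite addnC; exact: range_expX.
exists k; apply: poly_range => i; rewrite coef_map.
have [/hk //|hi] := ltnP i (size w).
rewrite (nth_default _ hi) raddf0; apply: subfield0; exact: range_is_subfield.
Qed.

(* Some Frobenius twist of w has its coefficients in F, and f divides its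
   composite with a power of 'X. *)
Lemma pi_elts_root_conj (f : {poly F}) (w : {poly E}) n x y :
    irreducible_poly f ->
    root (map_poly iota f) x -> root (map_poly iota f) y ->
    (forall i, pi_elts w`_i) -> root w (x ^+ (p ^ n)) ->
  root w (y ^+ (p ^ n)).
Proof.
move=> irr_f fx fy /pi_elts_poly[k [v wv]] wx.
have vE z : root w (z ^+ (p ^ n)) =
    root (map_poly iota (v \Po 'X^(p ^ (n + k)))) z.
  rewrite map_comp_poly map_polyXn !rootE horner_comp hornerXn -wv.
  by rewrite expnD exprM -frobn_horner frobn_eq0.
rewrite vE in wx; have /dvdpP[c cE] := irreducible_dvdp irr_f fx wx.
by rewrite vE cE rmorphM rootM fy orbT.
Qed.

(** Over [E], 'X^(p^n) - c is the [p ^ n]-th power of 'X - x. Its gcd with [g] is defined over [F],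
    is a power of 'X - x and is separable; so it is 'X - x up to a scalar, and its root comes from
    [F]. *)
Lemma separable_root_range (g : {poly F}) n x : separable_poly g ->
  root (map_poly iota g) x -> range iota (x ^+ (p ^ n)) -> range iota x.
Proof.
move=> sep_g gx [c _ cx].
pose d := gcdp g ('X^(p ^ n) - c%:P).
have dE : map_poly iota d = gcdp (map_poly iota g) (('X - x%:P) ^+ (p ^ n)).
  rewrite gcdp_map rmorphB /= map_polyXn map_polyC /= cx polyC_exp.
  have hq : [pchar {poly E}].-nat (p ^ n)%N.
    by rewrite pnatX pnatE ?pchar_poly ?hp // (pcharf_prime hp).
  by rewrite exprDn_pchar // exprNn_pchar.
have : map_poly iota d %| ('X - x%:P) ^+ (p ^ n) by rewrite dE dvdp_gcdr.
case/dvdp_exp_XsubCP => j _ dj.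
have rd : root (map_poly iota d) x.
  rewrite dE root_gcd gx rootE horner_exp hornerXsubC subrr expr0n.
  by rewrite gtn_eqF ?eqxx // expn_gt0 prime_gt0 // (pcharf_prime hp).
have sep_d : separable_poly (map_poly iota d).
  by rewrite separable_map; apply: dvdp_separable sep_g; exact: dvdp_gcdl.
have j1 : j = 1%N.
  case: j dj => [|[|j]] // dj.
    by move: rd; rewrite (eqp_root dj) expr0 (negbTE (root1 _)).
  have := separable_nosquare (k := j.+2) sep_d isT (u := 'X - x%:P).
  by rewrite size_XsubC -(eqp_dvdl _ dj) dvdpp => /(_ isT).
rewrite j1 expr1 in dj.
have /poly2_root[b db] : size d = 2.
  by rewrite -(size_map_poly iota) (eqp_size dj) size_XsubC.
exists b => //; apply/eqP; rewrite -root_XsubC -(eqp_root dj).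
by rewrite fmorph_root.
Qed.

End PurelyInseparable.

(** * Simple algebraic extensions as sets of polynomial values *)

Section SimpleExtension.

Variables (F E : fieldType) (iota : {rmorphism F -> E}) (x : E).

Definition simple_ext : set E :=
  range (fun h : {poly F} => (map_poly iota h).[x]).

Lemma simple_ext_base : range iota `<=` simple_ext.
Proof. by move=> _ [a _ <-]; exists a%:P; rewrite // map_polyC hornerC. Qed.

Lemma simple_ext_gen : simple_ext x.
Proof. by exists 'X; rewrite // map_polyX hornerX. Qed.

Lemma simple_ext_modp (r : {poly F}) y :
    r != 0 -> root (map_poly iota r) x ->
    simple_ext y ->
  exists2 h : {poly F}, (size h < size r)%N & y = (map_poly iota h).[x].
Proof.
move=> r0 rx [h _ <-]; exists (h %% r); first by rewrite ltn_modp.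
rewrite {1}(divp_eq h r) rmorphD rmorphM !hornerE.
by rewrite (rootP rx) mulr0 add0r.
Qed.

Hypothesis alg_x : algebraicOver iota x.

(** Inverses come from a Bezout relation between [g] and the minimal polynomial [q] of [x],
    evaluated at [x]. *)
Lemma simple_ext_subfield : is_subfield simple_ext.
Proof.
split.
- by rewrite inE; exists 1; rewrite // rmorph1 hornerC.
- move=> y z; rewrite !inE => -[h _ <-] [g _ <-].
  by exists (h - g); rewrite // rmorphB !hornerE.
move=> y z; rewrite !inE => -[h _ <-] [g _ <-].
have [-> | gx0] := eqVneq (map_poly iota g).[x] 0.
  by rewrite invr0 mulr0; exists 0; rewrite // rmorph0 horner0.
have [q [_ irr_q qx]] := algebraic_irreducible alg_x.
have : coprimep q g.
  rewrite irreducible_poly_coprime //; apply: contra gx0 => /dvdpP[c ->].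
  by rewrite rmorphM hornerM (rootP qx) mulr0.
case/Bezout_coprimepP => -[u v] /= /eqpP[[a b] /= /andP[a0 b0]].
move/(congr1 (fun w => (map_poly iota w).[x])).
rewrite !map_polyZ rmorphD !rmorphM rmorph1 !hornerE (rootP qx) mulr0 add0r.
move=> uv.
have -> : (map_poly iota g).[x]^-1 = iota (a / b) * (map_poly iota v).[x].
  apply: (mulIf gx0); rewrite mulVf // fmorph_div -mulrA mulrAC uv.
  by rewrite divff // fmorph_eq0.
exists ((a / b) *: (h * v)) => //.
by rewrite map_polyZ hornerZ (rmorphM (map_poly iota)) hornerM mulrCA.
Qed.

Lemma adjoin_simple_ext : adjoin (range iota) [set x] = simple_ext.
Proof.
apply/seteqP; split.
  apply: gen_field_sub; first exact: simple_ext_subfield.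
  by move=> y [/simple_ext_base //|->]; exact: simple_ext_gen.
move=> _ [h _ <-]; apply: (subfield_horner (gen_field_subfield _)).
  by move=> i; rewrite coef_map; apply: sub_gen_smallest; left; exists h`_i.
by apply: sub_gen_smallest; right.
Qed.

End SimpleExtension.

(* If the minimal polynomial q of x were inseparable, it would be t^p with
   t(x) = 0 and the coefficients of t purely inseparable over F, so that r
   divides t o h for x = h(a); by [descent_relation], x would then be a root
   of a nonzero polynomial over F of degree at most deg t < deg q. *)
Lemma separable_simple_ext (F : fieldType) (E : closedFieldType)
    (iota : {rmorphism F -> E}) p (r : {poly F}) a x :
    p \in [pchar E] -> r != 0 -> root (map_poly iota r) a ->
    (forall w : {poly E}, (forall i, pi_elts iota p w`_i) -> root w a ->
       map_poly iota r %| w) ->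
    algebraicOver iota x -> simple_ext iota a x ->
  separable_elt iota x.
Proof.
move=> hp r0 ra r_min alg_x [h _ hx].
have [q [mon_q irr_q qx]] := algebraic_irreducible alg_x.
exists q; split=> //; apply: contraT => nsep_q.
have p_gt0 : (0 < p)%N by rewrite prime_gt0 // (pcharf_prime hp).
(* For degree reasons, an irreducible polynomial is coprime to its derivative unless the latter is
   zero. *)
have q'0 : q^`() = 0.
  apply/eqP; apply: contraNT nsep_q => q'0.
  rewrite separable_poly.unlock irreducible_poly_coprime // gtNdvdp //.
  by rewrite lt_size_deriv // irredp_neq0.
(* [t] keeps the coefficients of [q] at multiples of [p] and takes their [p]-th roots; the other
   coefficients vanish because the derivative does, so [q] is the [p]-th power of [t] over [E]. *)
pose t := \poly_(i < ((size q).-1 %/ p).+1) proot p 1 (iota q`_(i * p)).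
have tE : map_poly (frobn hp 1) t \Po 'X^p = map_poly iota q.
  apply/polyP => i; rewrite coef_comp_poly_Xn // !coef_map coef_poly.
  case: ifPn => [pi|npi].
    rewrite ltnS divnK //; case: leqP => [_|lt_i].
      by rewrite -[LHS]/(_ ^+ _) proot_spec.
    rewrite ltn_divLR // divnK // in lt_i.
    by rewrite raddf0 nth_default ?raddf0 // (leq_trans (leqSpred _)).
  have i_gt0 : (0 < i)%N by case: (i) npi; rewrite ?dvdn0.
  have /eqP := congr1 (fun w : {poly F} => w`_i.-1) q'0.
  rewrite coef_deriv prednK // coef0 -mulr_natr mulf_eq0.
  rewrite -(dvdn_pcharf (p := p)) ?(negPf npi) ?orbF; last first.
    by rewrite -(fmorph_pchar iota).
  by move/eqP ->; rewrite raddf0.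
have tx : root t x.
  rewrite rootE -(frobn_eq0 hp 1) frobn_horner expn1 -[x ^+ p]hornerXn.
  by rewrite -horner_comp tE.
have t0 : t != 0.
  apply: contraTneq (irredp_neq0 irr_q) => t0.
  by rewrite -(map_poly_eq0 iota) -tE t0 rmorph0 comp_poly0 eqxx.
have lt_t : (size t < size q)%N.
  apply: leq_ltn_trans (size_poly _ _) _.
  case: (size q) irr_q.1 => [|[|d]] // _.
  by rewrite /= ltnS ltn_Pdiv // prime_gt1 // (pcharf_prime hp).
have hpi := pi_elts_subfield iota hp.
have t_pi i : pi_elts iota p t`_i.
  rewrite coef_poly; case: ifP => _; last exact: subfield0.
  by exists 1%N; rewrite proot_spec //; exists q`_(i * p).
(* [J] serves to show that [t \Po h] has purely inseparable coefficients, as the minimality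
   hypothesis on [r] requires. *)
have [j [J jJ]] := subfield_range hpi.
have : map_poly iota r %| t \Po map_poly iota h.
  apply: r_min; last by rewrite rootE horner_comp hx -rootE.
  have [|t' ->] := poly_range (iota := J) (w := t); first by rewrite jJ.
  have [|h' ->] := poly_range (iota := J) (w := map_poly iota h).
    by move=> i; rewrite jJ coef_map; apply: range_pi_elts; exists h`_i.
  by move=> i; rewrite -map_comp_poly coef_map -jJ; exists (t' \Po h')`_i.
case/(descent_relation r0 t0) => u [u0 le_u /dvdpP[c uc]].
have ux : root (map_poly iota u) x.
  rewrite -hx rootE -horner_comp -map_comp_poly uc rmorphM hornerM.
  by rewrite (rootP ra) mulr0.
have := dvdp_leq u0 (irreducible_dvdp irr_q qx ux).
by rewrite leqNgt (leq_ltn_trans le_u lt_t).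
Qed.

(** An expression of [y] as a polynomial in [x] over [M] is reduced modulo [g], which bounds its
    size. *)
Lemma adjoin_horner (E : fieldType) (M : set E) (g : {poly E}) x y :
    is_subfield M -> (forall i, M g`_i) -> g != 0 -> root g x ->
    adjoin M [set x] y ->
  exists w : {poly E},
    [/\ forall i, M w`_i, (size w < size g)%N & y = w.[x]].
Proof.
move=> hM gM g0 gx; have [F [j jM]] := subfield_range hM.
have [|v gv] := poly_range (iota := j) (w := g); first by rewrite jM.
rewrite gv map_poly_eq0 in g0; rewrite gv in gx.
rewrite -jM adjoin_simple_ext; last by exists v.
case/(simple_ext_modp g0 gx) => h lt_h ->.
exists (map_poly j h); split=> //; last by rewrite gv !size_map_poly.
by move=> i; rewrite coef_map; exists h`_i.
Qed.

(** An empty maximum is 0 as well; the condition at [ord0] ensures that the value is reached at an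
    index satisfying [P]. *)
Lemma bigmax_ord_attained n (P : pred 'I_n.+1) : P ord0 ->
  exists2 i, P i & \max_(m < n.+1 | P m) m = i :> nat.
Proof.
move=> P0.
have [|i Pi ->] := eq_bigmax_cond (fun m : 'I_n.+1 => m : nat) (A := P).
  by apply/card_gt0P; exists ord0.
by exists i.
Qed.

Lemma proot0 (E : closedFieldType) p (x : E) :
  p \in [pchar E] -> proot p 0 x = x.
Proof. by move=> hp; rewrite -(@proot_uniq _ p 0 x x) // expn0 expr1. Qed.

Lemma linear_on_sum (F E : fieldType) (iota : {rmorphism F -> E})
    (V : lmodType F) (C : set E) (phi : E -> V) m (c : 'I_m -> F)
    (x : 'I_m -> E) :
    is_subfield C -> range iota `<=` C -> linear_on iota C phi ->
    (forall i, C (x i)) ->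
  phi (\sum_(i < m) iota (c i) * x i) = \sum_(i < m) c i *: phi (x i).
Proof.
move=> hC FC lin_phi; elim: m c x => [|m IHm] c x Cx.
  have C0 := subfield0 hC; rewrite !big_ord0.
  have := lin_phi 1 0 0 C0 C0; rewrite rmorph1 mul1r scale1r addr0.
  by move/(canLR (addrK _)); rewrite subrr.
rewrite !big_ord_recl lin_phi ?IHm //; apply: (subfield_sum hC) => i _.
by apply: (subfieldM hC) => //; apply: FC; exists (c (lift ord0 i)).
Qed.

(** * The element [alpha] and its minimal polynomial [r] over [N] *)

Section Main.

Variables (K N : fieldType) (Kbar : closedFieldType) (p : nat).
Variables (iKN : {rmorphism K -> N}) (iN : {rmorphism N -> Kbar}).
Variables (theta : Kbar) (f fsep : {poly K}) (n : nat).
Hypotheses (hp : p \in [pchar Kbar])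
  (hKbar : forall x : Kbar, algebraicOver (iN \o iKN) x)
  (hN : purely_inseparable_ext iKN p [set: N])
  (hf_monic : f \is monic) (hf_irr : irreducible_poly f)
  (hf_root : root (map_poly (iN \o iKN) f) theta)
  (hfsep : separable_poly fsep) (hf : f = fsep \Po 'X^(p ^ n)).

Let iK : {rmorphism K -> Kbar} := iN \o iKN.
Let alpha : Kbar := theta ^+ (p ^ n).
Let s : nat := (size fsep).-1.
Let lambda (i : nat) : Kbar := iK fsep`_i.
Let r : {poly N} := map_poly iKN fsep.
Let g : {poly Kbar} := \poly_(i < size fsep) proot p n (lambda i).
Let NL : set Kbar := compositum (range iN) (adjoin (range iK) [set theta]).
Let NLpi : set Kbar := max_pi iN p NL.
Let NLsep : set Kbar := max_sep iN NL.

Let q_gt0 : (0 < p ^ n)%N.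
Proof. by rewrite expn_gt0 prime_gt0 // (pcharf_prime hp). Qed.

Let fsep_monic : fsep \is monic.
Proof.
move: hf_monic; rewrite hf !monicE lead_coef_comp ?size_polyXn ?ltnS //.
by rewrite lead_coefXn expr1n mulr1.
Qed.

Let size_fsep : size fsep = s.+1.
Proof. by rewrite prednK // size_poly_gt0 monic_neq0. Qed.

Let mapr : map_poly iN r = map_poly iK fsep.
Proof. by rewrite /r -map_poly_comp. Qed.

Let r_neq0 : r != 0.
Proof. by rewrite map_poly_eq0 monic_neq0. Qed.

Let root_f x : root (map_poly iK f) x = root (map_poly iN r) (x ^+ (p ^ n)).
Proof.
by rewrite mapr hf map_comp_poly map_polyXn !rootE horner_comp hornerXn.
Qed.

Let r_alpha : root (map_poly iN r) alpha.
Proof. by rewrite -root_f. Qed.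

Let s_gt0 : (0 < s)%N.
Proof.
rewrite -ltnS -size_fsep -(size_map_poly iK) -mapr.
by apply: (root_size_gt1 (a := alpha)) => //; rewrite map_poly_eq0.
Qed.

Let pi_elts_trans x : pi_elts iN p x -> pi_elts iK p x.
Proof.
case=> k [y _ xy]; have [j [z _ zy]] := hN (x := y) I.
by exists (k + j)%N; rewrite expnD exprM -xy -rmorphXn -zy; exists z.
Qed.

Let r_separable : separable_poly (map_poly iN r).
Proof. by rewrite mapr separable_map. Qed.

Let r_min (w : {poly Kbar}) : (forall i, pi_elts iN p w`_i) ->
  root w alpha -> map_poly iN r %| w.
Proof.
move=> hw wa; apply: separable_dvdp => // x.
(* A root of [r] is the [p ^ n]-th power of a root of [f], that is, of a conjugate of [theta]. *)
rewrite -{1}(proot_spec n x hp) -root_f => fx.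
rewrite -(proot_spec n x hp).
apply: (pi_elts_root_conj hp hf_irr hf_root) => // i.
exact: pi_elts_trans.
Qed.

(** A nonzero [w] would be a multiple of [r], whose degree is [s]. *)
Let r_indep (w : {poly Kbar}) : (forall i, pi_elts iN p w`_i) ->
  (size w <= s)%N -> root w alpha -> w = 0.
Proof.
move=> hw le_w wa; apply: contraTeq le_w => w0; rewrite -ltnNge.
by rewrite -[(s < _)%N]/(s.+1 <= _)%N -size_fsep -(size_map_poly iK) -mapr
  dvdp_leq // r_min.
Qed.

Let alg_N x : algebraicOver iN x.
Proof.
have [h h0 hx] := hKbar x; exists (map_poly iKN h).
  by rewrite map_poly_eq0.
by rewrite -map_poly_comp.
Qed.

(** * Description of [NL], [NLpi] and [NLsep] *)

Let NLE : NL = simple_ext iN theta.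
Proof.
rewrite -adjoin_simple_ext //; apply/seteqP; split.
  apply: (gen_field_sub (gen_field_subfield _)).
  move=> x [Nx|]; first exact: compositum_l.
  apply: (gen_field_sub (gen_field_subfield _)).
  move=> y [[z _ <-]|->]; last exact: compositum_r.
  by apply: compositum_l; exists (iKN z).
apply: (gen_field_sub (gen_field_subfield _)).
move=> x [|->]; first exact: compositum_l.
by apply: compositum_r; apply: compositum_r.
Qed.

Let NL_subfield : is_subfield NL.
Proof. exact: gen_field_subfield. Qed.

Let range_NL : range iN `<=` NL.
Proof. exact: compositum_l. Qed.

Let theta_NL : NL theta.
Proof. by apply: compositum_r; exact: compositum_r. Qed.

(** The purely inseparable elements of [NL] form a field, so the union of the purely inseparable
    subextensions is itself one of them. *)
Let NLpiE : NLpi = NL `&` pi_elts iN p.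
Proof.
apply/seteqP; split=> [x [A [[_ _ subA] piA] Ax]|x NLx].
  by split; [exact: subA|exact: piA].
exists (NL `&` pi_elts iN p) => //; split; last by move=> y [].
split=> [| |y []//].
  exact: subfieldI NL_subfield (pi_elts_subfield iN hp).
by move=> y Ny; split; [exact: range_NL|exact: range_pi_elts].
Qed.

(** A separable element of [NL] is separable over N(alpha) and has its [p ^ n]-th power there, so it
    lies in N(alpha). Conversely, N(alpha) is separable by [separable_simple_ext] and [r_min]. *)
Let NLsepE : NLsep = simple_ext iN alpha.
Proof.
have hS : is_subfield (simple_ext iN alpha) by exact: simple_ext_subfield.
apply/seteqP; split=> [x [A [[_ _ subA] sepA] Ax]|x Sx].
  have [F [j jS]] := subfield_range hS.
  have [q [_ _ qx sep_q]] := sepA x Ax.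
  have [|q' qq'] := poly_range (iota := j) (w := map_poly iN q).
    by move=> i; rewrite jS coef_map; apply: simple_ext_base; exists q`_i.
  rewrite -jS; apply: (separable_root_range hp (g := q') (n := n)).
  - by rewrite -(separable_map j) -qq' separable_map.
  - by rewrite -qq'.
  (* With x = h(theta), the power [x ^+ (p ^ n)] is the Frobenius twist of [h] evaluated at
     [alpha]. *)
  have := subA x Ax; rewrite NLE jS => -[h _ <-].
  rewrite -[_ ^+ _]/(frobn hp n _) frobn_horner -/alpha.
  apply: subfield_horner => //; last exact: simple_ext_gen.
  move=> i; rewrite !coef_map /=; apply: simple_ext_base.
  by exists (h`_i ^+ (p ^ n)); rewrite // rmorphXn.
exists (simple_ext iN alpha) => //; split=> [|y Sy].
  split=> //; first exact: simple_ext_base.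
  move=> _ [h _ <-]; apply: (subfield_horner NL_subfield).
    by move=> i; rewrite coef_map; apply: range_NL; exists h`_i.
  exact: (subfieldX NL_subfield).
exact: separable_simple_ext hp r_neq0 r_alpha r_min _ Sy.
Qed.

(** * Coordinates over [NLpi] and the tensor product *)

Let NLpi_subfield : is_subfield NLpi.
Proof.
by rewrite NLpiE; exact: subfieldI NL_subfield (pi_elts_subfield iN hp).
Qed.

Let range_NLpi : range iN `<=` NLpi.
Proof.
by move=> x Nx; rewrite NLpiE; split; [exact: range_NL|exact: range_pi_elts].
Qed.

Let NLpi_pi x : NLpi x -> pi_elts iN p x.
Proof. by rewrite NLpiE => -[]. Qed.

Let NLpi_indep (w : {poly Kbar}) : (forall i, NLpi w`_i) ->
  (size w <= s)%N -> w.[alpha] = 0 -> w = 0.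
Proof. by move=> hw ? /rootP; apply: r_indep => // i; exact: NLpi_pi. Qed.

Let NLsep_horner x : NLsep x ->
  exists2 h : {poly N}, (size h <= s)%N & x = (map_poly iN h).[alpha].
Proof.
rewrite NLsepE => /(simple_ext_modp r_neq0 r_alpha)[h + ->].
by rewrite size_map_poly size_fsep ltnS; exists h.
Qed.

Let compositum_horner x : compositum NLpi NLsep x ->
  exists w : {poly Kbar},
    [/\ forall i, NLpi w`_i, (size w <= s)%N & x = w.[alpha]].
Proof.
have rpi i : NLpi (map_poly iN r)`_i.
  by rewrite coef_map; apply: range_NLpi; exists r`_i.
move=> Cx.
have [||w [? + ->]] := adjoin_horner NLpi_subfield rpi _ r_alpha (y := x).
- by rewrite map_poly_eq0.
- apply: (gen_field_sub (gen_field_subfield _)) Cx => y [|].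
    exact: compositum_l.
  rewrite NLsepE -adjoin_simple_ext //.
  apply: (gen_field_sub (gen_field_subfield _)) => z [|->].
    by move/range_NLpi; exact: compositum_l.
  exact: compositum_r.
by rewrite mapr size_map_poly size_fsep ltnS; exists w.
Qed.

Let NLpi_coef (a : Kbar) (w : {poly Kbar}) : NLpi a ->
  (forall i, NLpi w`_i) -> forall i, NLpi (a *: w)`_i.
Proof. by move=> ? ? i; rewrite coefZ; exact: (subfieldM NLpi_subfield). Qed.

Let NLpi_coef_map (h : {poly N}) i : NLpi (map_poly iN h)`_i.
Proof. by rewrite coef_map; apply: range_NLpi; exists h`_i. Qed.

(** The powers of [alpha] below [s] form a basis of [NLsep] over [N] and of the compositum over
    [NLpi]. A bilinear map is thus determined by its values on pairs of an element of [NLpi] and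
    such a power. *)
Lemma tensor_product_pi_sep :
  is_tensor_product iN NLpi NLsep (compositum NLpi NLsep).
Proof.
have hC : is_subfield (compositum NLpi NLsep) by exact: gen_field_subfield.
have hS : is_subfield NLsep by rewrite NLsepE; exact: simple_ext_subfield.
have range_NLsep : range iN `<=` NLsep.
  by rewrite NLsepE; exact: simple_ext_base.
have sep_alpha i : NLsep (alpha ^+ i).
  by apply: (subfieldX hS); rewrite NLsepE; exact: simple_ext_gen.
split=> [a b Aa Bb|V beta [linL linR]].
  by apply: (subfieldM hC); [exact: compositum_l|exact: compositum_r].
(* The value at 0 is read off from the empty sum in [linear_on_sum]. *)
have b0 b : NLsep b -> beta 0 b = 0.
  move=> Bb; have := linear_on_sum (fun _ : 'I_0 => 0) (x := fun=> 0)
    NLpi_subfield range_NLpi (linL b Bb).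
  by rewrite !big_ord0; apply; case.
have bZ b c x : NLpi x -> NLsep b -> beta (iN c * x) b = c *: beta x b.
  move=> Ax Bb; have := linL b Bb c x 0 Ax (subfield0 NLpi_subfield).
  by rewrite !addr0 b0 // addr0.
(* [P x] will be the coordinate polynomial of [x], unique by [NLpi_indep]; the default 0 only serves
   outside the compositum. *)
pose good x := [set w : {poly Kbar} |
  [/\ forall i, NLpi w`_i, (size w <= s)%N & x = w.[alpha]]].
pose P x := xget 0 (good x).
have PE x w : good x w -> P x = w.
  move=> gw; rewrite /P; case: xgetP => [v _ gv|/(_ w)/(_ gw) //].
  have [[wA lew xw] [vA lev xv]] := (gw, gv).
  apply/eqP; rewrite -subr_eq0; apply/eqP; apply: NLpi_indep.
  - by move=> i; rewrite coefB; exact: (subfieldB NLpi_subfield).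
  - by rewrite (leq_trans (size_polyD _ _)) // size_polyN geq_max lew lev.
  by rewrite hornerD hornerN -xw -xv subrr.
pose phi x := \sum_(i < s) beta (P x)`_i (alpha ^+ i).
have phi_lin : linear_on iN (compositum NLpi NLsep) phi.
  move=> c x y /compositum_horner[v [vA lev xv]].
  move=> /compositum_horner[w [wA lew yw]].
  have -> : phi x = \sum_(i < s) beta v`_i (alpha ^+ i).
    by rewrite /phi (PE x v).
  have -> : phi y = \sum_(i < s) beta w`_i (alpha ^+ i).
    by rewrite /phi (PE y w).
  rewrite /phi (PE _ (iN c *: v + w)).
    rewrite scaler_sumr -big_split; apply: eq_bigr => i _.
    by rewrite coefD coefZ; exact: linL.
  split=> [i||]; last by rewrite hornerD hornerZ -xv -yw.
    rewrite coefD; apply: (subfieldD NLpi_subfield) => //.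
    by apply: NLpi_coef => //; apply: range_NLpi; exists c.
  rewrite (leq_trans (size_polyD _ _)) // geq_max lew.
  by rewrite (leq_trans (size_scale_leq _ _)).
have phiM a b : NLpi a -> NLsep b -> phi (a * b) = beta a b.
  move=> Aa /NLsep_horner[h le_h bh].
  rewrite /phi (PE _ (a *: map_poly iN h)); last first.
    split; first exact: NLpi_coef.
      by rewrite (leq_trans (size_scale_leq _ _)) // size_map_poly.
    by rewrite hornerZ -bh.
  have bE : b = \sum_(i < s) iN h`_i * alpha ^+ i.
    rewrite bh (horner_coef_wide (n := s)) ?size_map_poly //.
    by apply: eq_bigr => i _; rewrite coef_map.
  rewrite bE (linear_on_sum _ hS range_NLsep (linR a Aa)) //.
  by apply: eq_bigr => i _; rewrite coefZ coef_map mulrC bZ.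
exists phi; split=> // psi psi_lin psiM x Cx.
have [w [wA le_w ->]] := compositum_horner Cx.
have sumE (chi : Kbar -> V) : linear_on iN (compositum NLpi NLsep) chi ->
    (forall a b, NLpi a -> NLsep b -> chi (a * b) = beta a b) ->
    chi w.[alpha] = \sum_(i < s) beta w`_i (alpha ^+ i).
  move=> lin_chi chiM; rewrite (horner_coef_wide _ le_w).
  (* The coefficients of [w] lie in [NLpi] and need not be scalars from [N], so the sum is read with
     all scalars equal to 1. *)
  under eq_bigr do rewrite -[_ * _]mul1r -(rmorph1 iN).
  rewrite (linear_on_sum _ hC _ lin_chi) => [||i].
  - by apply: eq_bigr => i _; rewrite scale1r chiM.
  - by move=> y /range_NLpi; exact: compositum_l.
  by apply: (subfieldM hC); [exact: compositum_l|exact: compositum_r].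
by rewrite !sumE.
Qed.

(** * The polynomial [g] and the cycle of implications *)

Let proot_lambdaK i : proot p n (lambda i) ^+ (p ^ n) = lambda i.
Proof. exact: proot_spec. Qed.

Let gE i : (i <= s)%N -> g`_i = proot p n (lambda i).
Proof. by move=> le_i; rewrite coef_poly size_fsep ltnS le_i. Qed.

Let g_frobn : map_poly (frobn hp n) g = map_poly iN r.
Proof.
apply/polyP => i; rewrite mapr !coef_map coef_poly; case: ltnP => [_|le_i].
  exact: proot_lambdaK.
by rewrite (nth_default 0 le_i) !raddf0.
Qed.

Let size_g : size g = s.+1.
Proof. by rewrite -(size_map_poly (frobn hp n)) g_frobn mapr size_map_poly. Qed.

Let g_lead : g`_s = 1.
Proof.
apply: (frobn_inj (hp := hp) (n := n)); rewrite rmorph1.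
rewrite gE // -[LHS]/(_ ^+ _) proot_lambdaK /lambda.
by rewrite -[fsep`_s]/(lead_coef fsep) (monicP fsep_monic) rmorph1.
Qed.

Let g_theta : root g theta.
Proof. by rewrite rootE -(frobn_eq0 hp n) frobn_horner g_frobn. Qed.

Let g_neq0 : g != 0.
Proof. by rewrite -size_poly_gt0 size_g. Qed.

Let g_coef (M : set Kbar) : is_subfield M ->
  (forall i, (i < s)%N -> M (proot p n (lambda i))) -> forall i, M g`_i.
Proof.
move=> hM lamM i; have [lt_i|gt_i|->] := ltngtP i s.
- by rewrite gE; [exact: lamM|exact: ltnW].
- by rewrite nth_default ?size_g //; exact: subfield0.
by rewrite g_lead; exact: subfield1.
Qed.

(* As alpha has degree s over NLpi and theta lies in NLpi(alpha), the powers
   1, theta, .., theta^s satisfy a relation u over NLpi; its Frobenius twist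
   annihilates alpha, so it is proportional to the minimal polynomial of
   alpha. *)
Let proot_NLpi : NL = compositum NLpi NLsep ->
  forall i, (i < s)%N -> NLpi (proot p n (lambda i)).
Proof.
move=> NLC; have := theta_NL; rewrite NLC => /compositum_horner[w [wA _ tw]].
have [F [j jE]] := subfield_range NLpi_subfield.
have [|w' ww'] := poly_range (iota := j) (w := w); first by rewrite jE.
have [|r' rr'] := poly_range (iota := j) (w := map_poly iN r).
  by move=> i; rewrite jE; exact: NLpi_coef_map.
have r'0 : r' != 0 by rewrite -(map_poly_eq0 j) -rr' map_poly_eq0.
have [rs rrs] := closed_field_poly_normal (map_poly iN r).
have lr0 : lead_coef (map_poly iN r) != 0 by rewrite lead_coef_eq0 map_poly_eq0.
(* The roots of [t] are the values of [w] at the roots of [r], so [r] divides [t \Po w]. The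
   coefficients of [t] are only known to lie in [Kbar]; descent replaces it by some [u] over [NLpi]
   of no larger size. *)
pose t := \prod_(a <- rs) ('X - w.[a]%:P).
have size_t : size t = s.+1.
  rewrite size_prod_XsubC -(size_prod_XsubC rs id) -(size_scale _ lr0) -rrs.
  by rewrite mapr size_map_poly.
have t0 : t != 0 by rewrite -size_poly_gt0 size_t.
have : map_poly j r' %| t \Po map_poly j w'.
  rewrite -rr' -ww'; apply: separable_dvdp => // a.
  rewrite {1}rrs rootZ // root_prod_XsubC => a_rs.
  rewrite rootE horner_comp -rootE /t -(big_map (fun a => w.[a]) xpredT
    (fun b => 'X - b%:P)) root_prod_XsubC.
  exact: map_f.
case/(descent_relation r'0 t0) => u [u0 le_u /dvdpP[c uc]].
have uA i : NLpi (map_poly j u)`_i by rewrite -jE coef_map; exists u`_i.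
have r'_alpha : root (map_poly j r') alpha by rewrite -rr'.
have ut : root (map_poly j u) theta.
  rewrite tw ww' rootE -horner_comp -map_comp_poly uc rmorphM hornerM.
by rewrite (rootP r'_alpha) mulr0.
pose U := map_poly (frobn hp n) (map_poly j u).
have rU : map_poly iN r %| U.
  apply: r_min; last by rewrite rootE -frobn_horner frobn_eq0.
  move=> i; rewrite coef_map; apply: NLpi_pi; exact: (subfieldX NLpi_subfield).
have U0 : U != 0 by rewrite !map_poly_eq0.
have : map_poly iN r %= U.
  rewrite -dvdp_size_eqp // eqn_leq dvdp_leq // mapr !size_map_poly.
  by rewrite size_fsep -size_t.
case/eqpP => -[a b] /= /andP[a0 b0] rUE i lt_i.
have coefE k : a * iN r`_k = b * (j u`_k) ^+ (p ^ n).
  have /(congr1 (fun v : {poly Kbar} => v`_k)) := rUE.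
  by rewrite !coefZ !coef_map.
have r_s : iN r`_s = 1.
  rewrite -coef_map mapr coef_map /= -[fsep`_s]/(lead_coef fsep).
  by rewrite (monicP fsep_monic) !rmorph1.
have us0 : j u`_s != 0.
  apply: contraNneq a0 => us0; have := coefE s; rewrite r_s mulr1 us0 => ->.
  by rewrite expr0n gtn_eqF // mulr0.
(* Dividing the relation [coefE] at [i] by the one at [s], where [r] has coefficient 1, exhibits the
   root of [lambda i]. *)
rewrite -(@proot_uniq _ p n (lambda i) (j u`_i / j u`_s)) //.
  apply: (subfieldM NLpi_subfield); first by rewrite -jE; exists u`_i.
  by apply: (subfieldV NLpi_subfield); rewrite -jE; exists u`_s.
have usE : a = b * j u`_s ^+ (p ^ n) by rewrite -coefE r_s mulr1.
rewrite exprMn exprVn; apply: (mulfI a0).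
rewrite [lambda i](_ : _ = iN r`_i); last by rewrite coef_map.
rewrite coefE {1}usE -mulrA; congr (_ * _).
by rewrite mulrCA divff ?mulr1 // expf_neq0.
Qed.

(** The index 0 is recovered from g(theta) = 0, which expresses the constant coefficient of [g]
    through [theta] and the other coefficients. *)
Let proot_NL_lt :
  (forall i, (1 <= i <= s.-1)%N -> NL (proot p n (lambda i))) ->
  forall i, (i < s)%N -> NL (proot p n (lambda i)).
Proof.
have hNL := NL_subfield.
move=> lamNL i lt_i; have [i0|i_gt0] := posnP i; last first.
  by apply: lamNL; rewrite i_gt0 -ltnS prednK.
rewrite i0 -gE //; have /eqP := g_theta.
rewrite horner_coef size_g big_ord_recl mulr1 => /eqP.
rewrite addr_eq0 => /eqP ->.
rewrite -sub0r; apply: (subfieldB hNL); first exact: (subfield0 hNL).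
apply: (subfield_sum hNL) => k _.
apply: (subfieldM hNL); last exact: (subfieldX hNL).
rewrite lift0; have [ks|ks] := eqVneq k.+1 s.
  by rewrite ks g_lead; exact: (subfield1 hNL).
have lt_k : (k.+1 < s)%N by rewrite ltn_neqAle ks ltn_ord.
by rewrite gE; [apply: lamNL; rewrite /= -ltnS prednK|exact: ltnW].
Qed.

(** The left side says that the largest index [n - mN] is admissible in the maximum defining
    [m_adjoin]. *)
Let proot_NL_m : (forall i, (i < s)%N -> NL (proot p n (lambda i))) <->
  n = (m_base iK p n fsep (range iN) + m_adjoin iK p n fsep (range iN) NL)%N.
Proof.
rewrite /m_adjoin; set mN := m_base _ _ _ _ _.
have [N_mN le_mN] : (forall i, (i < s)%N -> range iN (proot p mN (lambda i))) /\
    (mN <= n)%N.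
  rewrite /mN /m_base.
  case: (bigmax_ord_attained (n := n) (P := fun m => `[< forall i : nat,
    (i < s)%N -> range iN (proot p m (lambda i)) >])) => [|m /asboolP Nm ->].
    by apply/asboolP => i _; rewrite proot0.
  by split=> //; rewrite -ltnS.
pose P (m : 'I_(n - mN).+1) := `[< forall i : nat,
    (i < s)%N -> NL (proot p (mN + m) (lambda i)) >].
split=> [lamNL|].
  have Pm : P ord_max by apply/asboolP => i /=; rewrite subnKC //; exact: lamNL.
  have le_m : (n - mN <= \max_(m < (n - mN).+1 | P m) m)%N.
    exact: (bigmax_sup ord_max).
  apply/eqP; rewrite eqn_leq -leq_subLR le_m.
  rewrite -[X in (_ <= X)%N](subnKC le_mN) leq_add2l.
  by apply/bigmax_leqP => m _; rewrite -ltnS.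
case: (bigmax_ord_attained (P := P)) => [|m /asboolP NLm].
  (* Index 0 is admissible because the roots of exponent [mN] already lie in [N]. *)
  by apply/asboolP => i lt_i; rewrite addn0; apply: range_NL; exact: N_mN.
by rewrite /P => -> nE i lt_i; rewrite nE; exact: NLm.
Qed.

Let NLpi_gen : set Kbar := adjoin (range iN)
  [set proot p n (lambda i) | i in [set i : nat | (i < s)%N]].

Let NLpi_eq : (forall i, (i < s)%N -> NL (proot p n (lambda i))) ->
  NLpi = NLpi_gen.
Proof.
move=> lamNL; have subG : NLpi_gen `<=` NLpi.
  apply: (gen_field_sub NLpi_subfield) => x [/range_NLpi //|[i /= lt_i <-]].
  rewrite NLpiE; split; first exact: lamNL.
  by exists n; rewrite proot_lambdaK; exists (iKN fsep`_i).
have hG : is_subfield NLpi_gen by exact: gen_field_subfield.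
have gG : forall i, NLpi_gen g`_i.
  apply: g_coef => // i lt_i; apply: sub_gen_smallest; right.
  by exists i.
apply/seteqP; split=> // x Ax.
have : adjoin NLpi_gen [set theta] x.
  have := Ax; rewrite NLpiE NLE -adjoin_simple_ext // => -[+ _].
  apply: (gen_field_sub (gen_field_subfield _)) => y [Ny|->].
    by apply: compositum_l; apply: compositum_l.
  exact: compositum_r.
case/(adjoin_horner hG gG g_neq0 g_theta) => w [wG + xw].
rewrite size_g ltnS => le_w.
pose W := map_poly (frobn hp n) w - (x ^+ (p ^ n))%:P.
have W0 : W = 0.
  apply: NLpi_indep.
  - move=> i; rewrite coefB coefC coef_map; apply: (subfieldB NLpi_subfield).
      by apply: (subfieldX NLpi_subfield); exact: subG.
    case: ifP => _; first exact: (subfieldX NLpi_subfield).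
    exact: (subfield0 NLpi_subfield).
  - rewrite (leq_trans (size_polyD _ _)) // size_polyN geq_max size_map_poly.
    by rewrite le_w (leq_trans (size_polyC_leq1 _)).
  by rewrite hornerD hornerN hornerC -frobn_horner -xw subrr.
have -> : x = w`_0; last exact: wG.
apply: (frobn_inj (hp := hp) (n := n)); apply/eqP; rewrite eq_sym -subr_eq0.
have /(congr1 (fun v : {poly Kbar} => v`_0)) := W0.
by rewrite coefB coefC coef_map /= coef0 => /eqP.
Qed.

Let NL_compositum : NLpi = NLpi_gen -> NL = compositum NLpi NLsep.
Proof.
move=> AG.
have hC : is_subfield (compositum NLpi NLsep) by exact: gen_field_subfield.
have alphaC : compositum NLpi NLsep alpha.
  by apply: compositum_r; rewrite NLsepE; exact: simple_ext_gen.
have gC i : compositum NLpi NLsep g`_i.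
  apply: compositum_l; apply: (g_coef NLpi_subfield) => k lt_k.
  by rewrite AG; apply: sub_gen_smallest; right; exists k.
apply/seteqP; split.
  rewrite NLE -adjoin_simple_ext //.
  apply: (gen_field_sub hC) => x [/range_NLpi|->]; first exact: compositum_l.
  have [F [j jC]] := subfield_range hC.
  have [|v gv] := poly_range (iota := j) (w := g); first by rewrite jC.
  rewrite -jC; apply: (separable_root_range hp (g := v) (n := n)).
  (* [g] is separable because its Frobenius twist [r] is. *)
  - by rewrite -(separable_map j) -gv -(separable_map (frobn hp n)) g_frobn.
  - by rewrite -gv.
  by rewrite jC.
apply: (gen_field_sub NL_subfield) => x [|]; first by rewrite NLpiE => -[].
by case=> A [[_ _ subA] _] /subA.
Qed.

Lemma compositum_pi_sep_tfae :
  [<-> NL = compositum NLpi NLsep;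
       forall i : nat, (1 <= i <= s.-1)%N -> NL (proot p n (lambda i));
       n = (m_base iK p n fsep (range iN) +
            m_adjoin iK p n fsep (range iN) NL)%N;
       NLpi = NLpi_gen].
Proof.
tfae.
- move/proot_NLpi=> lamA i /andP[_ le_i].
  have /lamA : (i < s)%N by rewrite -(prednK s_gt0) ltnS.
  by rewrite NLpiE => -[].
- by move/proot_NL_lt/proot_NL_m.
- by move/proot_NL_m/NLpi_eq.
- exact: NL_compositum.
Qed.

End Main.

Theorem theorem3p11
    (K N : fieldType) (Kbar : closedFieldType)
    (p : nat) (hp : p \in [pchar K])
    (iKN : {rmorphism K -> N}) (iN : {rmorphism N -> Kbar})
    (hKbar : forall x : Kbar, algebraicOver (iN \o iKN) x)
    (hN : purely_inseparable_ext iKN p [set: N])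
    (theta : Kbar) (f fsep : {poly K}) (n : nat)
    (hf_monic : f \is monic) (hf_irr : irreducible_poly f)
    (hf_root : root (map_poly (iN \o iKN) f) theta)
    (hfsep : separable_poly fsep) (hf : f = fsep \Po 'X^(p ^ n)) :
  let iK : {rmorphism K -> Kbar} := iN \o iKN in
  let L : set Kbar := adjoin (range iK) [set theta] in
  let NL : set Kbar := compositum (range iN) L in
  let NLsep : set Kbar := max_sep iN NL in
  let NLpi : set Kbar := max_pi iN p NL in
  let s : nat := (size fsep).-1 in
  let lambda (i : nat) : Kbar := iK fsep`_i in
  is_tensor_product iN NLpi NLsep (compositum NLpi NLsep) /\
  [<-> NL = compositum NLpi NLsep;
       forall i : nat, (1 <= i <= s.-1)%N -> NL (proot p n (lambda i));
       n = (m_base iK p n fsep (range iN) + m_adjoin iK p n fsep (range iN) NL)%N;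
       NLpi = adjoin (range iN)
                [set proot p n (lambda i) | i in [set i : nat | (i < s)%N]]].
Proof.
have hpE : p \in [pchar Kbar] by rewrite (fmorph_pchar (iN \o iKN)).
split.
  exact: (tensor_product_pi_sep hpE hKbar hN hf_monic hf_irr hf_root hfsep hf).
exact: (compositum_pi_sep_tfae hpE hKbar hN hf_monic hf_irr hf_root hfsep hf).
Qed.
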